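(* Let $X_1,X_2,\dots$ be independent and identically distributed real random variables with $E[X_1]=0$, $0<\sigma^2:=E[X_1^2]$ and $\xi:=E|X_1|^3<\infty$. Let $p\in(0,1)$ and let $N=N_p$ be independent of the sequence $(X_j)_{j\ge1}$ with the geometric distribution $P(N=n)=p(1-p)^{n-1}$, $n=1,2,\dots$. Put $W:=\sqrt{p}\,\sum_{j=1}^{N}X_j$. Then $$d_{\mathcal K}\Bigl(\mathcal L(W),\mathrm{Laplace}\bigl(0,\tfrac{\sigma}{\sqrt2}\bigr)\Bigr)\le \frac{2C_{\mathcal K}\,\xi}{\sigma^3}\sqrt p+12p .$$
   Context: $\mathcal L(Y)$ denotes the distribution of a random variable $Y$. $d_{\mathcal K}(\mu,\nu):=\sup_{z\in\mathbb R}|\mu((-\infty,z])-\nu((-\infty,z])|$ is the Kolmogorov distance of probability measures on $\mathbb R$. $\mathrm{Laplace}(a,b)$, for $a\in\mathbb R$, $b>0$, is the distribution with density $x\mapsto\frac{1}{2b}e^{-|x-a|/b}$. $C_{\mathcal K}$ is the (finite, absolute) Berry-Esseen constant, i.e. a constant such that for all $n\ge1$ and all independent random variables $Y_1,\dots,Y_n$ with $E[Y_j]=0$, $E[Y_j^2]>0$, $E|Y_j|^3<\infty$, writing $B_n^2=\sum_{j=1}^nE[Y_j^2]$, one has $d_{\mathcal K}\bigl(\mathcal L(B_n^{-1}\sum_{j=1}^nY_j),N(0,1)\bigr)\le C_{\mathcal K}B_n^{-3}\sum_{j=1}^nE|Y_j|^3$. (Here $E[N]=1/p$, so $W=E[N]^{-1/2}\sum_{j=1}^NX_j$.)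 *)

(* Defs.v *)
From HB Require Import structures.
From mathcomp Require Import all_boot all_order all_algebra finmap.
From mathcomp Require Import all_classical all_reals all_analysis.
From mathcomp Require Import measurable_realfun.

Set Implicit Arguments.
Unset Strict Implicit.
Unset Printing Implicit Defensive.

Import Order.TTheory GRing.Theory Num.Theory.
Import numFieldNormedType.Exports.

Local Open Scope classical_set_scope.
Local Open Scope ring_scope.

Definition mutually_independent (d : measure_display) (T : measurableType d)
    (R : realType) (P : probability T R) (I : choiceType)
    (X : I -> {RV P >-> R}) : Prop :=
  forall (J : {fset I}) (B : I -> set R), (forall i, measurable (B i)) ->
    P (\bigcap_(i in [set` J]) (X i @^-1` B i)) =
    (\prod_(i <- J) P (X i @^-1` B i))%E.

Definition identically_distributed (d : measure_display)
    (T : measurableType d) (R : realType) (P : probability T R) (I : Type)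
    (X : I -> {RV P >-> R}) : Prop :=
  forall (i j : I) (B : set R), measurable B ->
    distribution P (X i) B = distribution P (X j) B.

Definition independent_of_sequence (d : measure_display)
    (T : measurableType d) (R : realType) (P : probability T R)
    (N : {RV P >-> nat}) (X : nat -> {RV P >-> R}) : Prop :=
  forall A B : set T,
    g_sigma_algebra_preimage N A ->
    <<s \bigcup_j g_sigma_algebra_preimage (X j) >> B ->
    P (A `&` B) = (P A * P B)%E.

(* Stated for set functions because the library gives the Borel sets of [R] two
   displays: [distribution P X] is a probability on [R] and [normal_prob] one on
   [measurableTypeR R]. *)
Definition kolmogorov_dist (R : realType) (mu nu : set R -> \bar R) : \bar R :=
  ereal_sup (range (fun z : R =>
    `|mu `]-oo, z]%classic - nu `]-oo, z]%classic|%E)).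

(* As [normal_pdf] does for a zero deviation, fall back on a uniform density
   when [b <= 0], so that [laplace_prob a b] is a probability for all [a], [b]. *)
Definition laplace_pdf (R : realType) (a b x : R) : R :=
  if 0 < b then (2 * b)^-1 * expR (- `|x - a| / b) else \1_`[0, 1] x.

Definition laplace_prob (R : realType) (a b : R) : set _ -> \bar R :=
  fun V => (\int[lebesgue_measure]_(x in V) (laplace_pdf a b x)%:E)%E.

Section laplace_density.
Variables (R : realType) (a b : R).

Lemma laplace_pdf_ge0 x : 0 <= laplace_pdf a b x.
Proof.
rewrite /laplace_pdf; case: ifPn => [b0|_]; last by rewrite indicE.
by rewrite mulr_ge0 ?expR_ge0// invr_ge0 mulr_ge0// ltW.
Qed.

Lemma continuous_laplace_pdf : 0 < b -> continuous (laplace_pdf a b : R -> R).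
Proof.
move=> b0 x; rewrite /laplace_pdf b0.
apply: (@continuousM _ R^o (fun=> _) (fun x => expR (- `|x - a| / b))).
  exact: cst_continuous.
apply: continuous_comp; last exact: continuous_expR.
apply: (@continuousM _ R^o (fun x => - `|x - a|) (fun=> b^-1)); last first.
  exact: cst_continuous.
apply: (@continuousN _ R^o); apply: continuous_comp; last exact: norm_continuous.
by apply: (@continuousB _ R^o) => //; exact: cst_continuous.
Qed.

Lemma measurable_laplace_pdf : measurable_fun [set: R] (laplace_pdf a b).
Proof.
have [b0|b0] := boolP (0 < b).
  by apply: continuous_measurable_fun; exact: continuous_laplace_pdf.
rewrite (_ : laplace_pdf a b = \1_`[0, 1]); first exact: measurable_indic.
by apply/funext => x; rewrite /laplace_pdf (negbTE b0).
Qed.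

End laplace_density.

Lemma integral_laplace_pdf (R : realType) (a b : R) :
  (\int[lebesgue_measure]_x (laplace_pdf a b x)%:E = 1)%E.
Proof.
have [b0|b0] := boolP (0 < b); last first.
  under eq_integral do rewrite /laplace_pdf (negbTE b0).
  by rewrite integral_indic//= setIT lebesgue_measure_itv/= lte01 oppr0 adde0.
have F'E : (fun x : R^o => x - a)^`()%classic = cst 1.
  by apply/funext => x; rewrite derive1E deriveD// derive_id derive_cst addr0.
transitivity (\int[lebesgue_measure]_x (laplace_pdf 0 b x)%:E)%E.
  rewrite (@increasing_ge0_integration_by_substitutionT _ (fun x : R => x - a)
     (laplace_pdf 0 b))//.
  - apply: eq_integral => x _ /=.
    by rewrite F'E/= !fctE mulr1 /laplace_pdf b0 subr0.
  - by move=> x y xy; rewrite ltrD2r.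
  - by rewrite F'E => ?; exact: cvg_cst.
  - by rewrite F'E; exact: is_cvg_cst.
  - by rewrite F'E; exact: is_cvg_cst.
  - exact: cvg_addrr_Ny.
  - exact: cvg_addrr.
  - exact: continuous_laplace_pdf.
  - by move=> x; exact: laplace_pdf_ge0.
rewrite ge0_symfun_integralT//=; last 3 first.
- by move=> x; exact: laplace_pdf_ge0.
- exact: continuous_laplace_pdf.
- by move=> x/=; rewrite /laplace_pdf b0 !subr0 normrN.
have bV0 : 0 < b^-1 by rewrite invr_gt0.
have := integral_exponential_pdf bV0.
have -> : [set x : R | 0 <= x] = `[0, +oo[%classic.
  by apply/seteqP; split => x/=; rewrite in_itv/= andbT.
rewrite -ge0_integralZl//=; last 2 first.
- by apply/measurable_EFinP/measurable_funTS; exact: measurable_laplace_pdf.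
- by move=> x _; rewrite lee_fin laplace_pdf_ge0.
move=> <-; rewrite [in LHS]integral_mkcond; apply: eq_integral => x _.
rewrite patchE /exponential_pdf patchE; case: ifPn => //.
rewrite inE/= in_itv/= andbT => x0.
rewrite /laplace_pdf b0 subr0 ger0_norm// -EFinM invfM.
by rewrite !mulrA divff// mul1r mulNr (mulrC x) mulNr.
Qed.

Section laplace_probability.
Variables (R : realType) (a b : R).
Local Notation laplace_prob := (laplace_prob a b).

Let laplace0 : laplace_prob set0 = 0%E.
Proof. by rewrite /laplace_prob integral_set0. Qed.

Let laplace_ge0 A : (0 <= laplace_prob A)%E.
Proof.
by rewrite /laplace_prob integral_ge0//= => x _; rewrite lee_fin laplace_pdf_ge0.
Qed.

Let laplace_sigma_additive : semi_sigma_additive laplace_prob.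
Proof.
move=> /= F mF tF mUF; rewrite /laplace_prob; apply: cvg_toP.
  apply: ereal_nondecreasing_is_cvgn => m n mn.
  apply: lee_sum_nneg_natr => // k _ _; apply: integral_ge0 => /= x Fkx.
  by rewrite lee_fin laplace_pdf_ge0.
rewrite ge0_integral_bigcup//=.
- apply/measurable_funTS/measurableT_comp => //.
  exact: measurable_laplace_pdf.
- by move=> x _; rewrite lee_fin laplace_pdf_ge0.
Qed.

HB.instance Definition _ := isMeasure.Build _ _ _
  laplace_prob laplace0 laplace_ge0 laplace_sigma_additive.

Let laplace_setT : laplace_prob [set: R] = 1%E.
Proof. by rewrite /laplace_prob integral_laplace_pdf. Qed.

HB.instance Definition _ :=
  @Measure_isProbability.Build _ _ R laplace_prob laplace_setT.

End laplace_probability.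

(* [X j] stands for the summand of index [j + 1], so this is the sum of the
   first [N] terms of the sequence. *)
Definition random_sum (d : measure_display) (T : measurableType d)
    (R : realType) (N : {mfun T >-> nat}) (X : nat -> {mfun T >-> R}) : T -> R :=
  fun w => \sum_(j < N w) X j w.

Section random_sum_measurable.
Context d (T : measurableType d) (R : realType).
Variables (N : {mfun T >-> nat}) (X : nat -> {mfun T >-> R}).

Let measurable_random_sum : measurable_fun [set: T] (random_sum N X).
Proof.
move=> _ B mB; rewrite setTI.
rewrite (_ : _ @^-1` B = \bigcup_n
    (N @^-1` [set n] `&` (\sum_(j < n) X j : {mfun T >-> R}) @^-1` B)).
  apply: bigcup_measurable => n _; apply: measurableI.
    exact: measurable_funPTI.
  exact: measurable_funPTI.
apply/seteqP; split => [w Bw|w [n _ [/= <-]]]; last by rewrite mfun_sum.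
by exists (N w) => //; split => //=; rewrite mfun_sum.
Qed.

HB.instance Definition _ :=
  isMeasurableFun.Build _ _ _ _ (random_sum N X) measurable_random_sum.

End random_sum_measurable.

Definition berry_esseen_constant (R : realType) (C : R) : Prop :=
  forall (d : measure_display) (T : measurableType d) (P : probability T R)
    (n : nat) (Y : 'I_n -> {RV P >-> R}),
    (1 <= n)%N ->
    mutually_independent Y ->
    (forall j, 'E_P[Y j] = 0)%E ->
    (forall j, 0 < 'E_P[fun w => (Y j w ^+ 2)%R])%E ->
    (forall j, 'E_P[fun w => (`|Y j w| ^+ 3)%R] < +oo)%E ->
    let B := Num.sqrt (\sum_j fine 'E_P[fun w => (Y j w ^+ 2)%R]) in
    let S : {RV P >-> R} := \sum_j (Y j : {mfun T >-> R}) in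
    (kolmogorov_dist (distribution P (B^-1 \o* S)%R) (normal_prob 0 1)
     <= (C * B ^- 3 * \sum_j fine 'E_P[fun w => (`|Y j w| ^+ 3)%R])%R%:E)%E.

(* Main.v *)
From HB Require Import structures.
Require Import Defs.
From mathcomp Require Import all_boot all_order all_algebra finmap.
From mathcomp Require Import all_classical all_reals all_analysis.
From mathcomp Require Import measurable_realfun.
From mathcomp Require Import ring lra.

Set Implicit Arguments.
Unset Strict Implicit.
Unset Printing Implicit Defensive.

Import Order.TTheory GRing.Theory Num.Theory.
Import numFieldNormedType.Exports.

Local Open Scope classical_set_scope.
Local Open Scope ring_scope.

(** Given [N = n], the variable [W] is [sqrt p] times a sum of [n] independent
    summands, so the Berry-Esseen inequality compares its law to the centred
    normal law of variance [p n sigma^2], with an error of order [1 / sqrt n].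
    Averaging over [N] costs [E (1 / sqrt N)], which is at most [2 sqrt p]
    ([sum_geom_invsqrt]); this is the first term of the bound, and it leaves a
    comparison of two mixtures of centred normal laws.

    Given [N], one may thus take [W] normal with variance [sigma^2 p N].  The
    Laplace law is the same mixture with [p N] replaced by a standard
    exponential variable: for [a > 0], with [Phi] the standard normal
    distribution function,
      [int_0^oo e^-t Phi (a / sqrt t) dt = 1 - e^-(sqrt 2 a) / 2].
    No integral is needed to exploit this identity, because the integrand has
    an explicit antiderivative, coming from the distribution function of the
    inverse Gaussian law.  In the variable [s = sqrt t] it is [mixprim a]; its
    limits at [0] and [+oo] differ by the right-hand side, which is the value
    at [a] of the distribution function of Laplace(0, 1 / sqrt 2)
    ([cvg_mixprim0], [cvg_mixprimy], [laplace_cdfE]).  Since [Phi (a / s)]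
    decreases in [s], the increments of [mixprim a] between the points
    [sqrt (p n)] are squeezed between terms of the sum of the [Phi (a / sqrt
    (p n))] with geometric weights of ratio [e^-p]; telescoping costs at most
    [1 - e^-p <= p] ([lower_sum_dist]), and trading the ratio [e^-p] for
    [1 - p] costs another [p] ([geom_expR_dist]).  The case [a < 0] follows by
    symmetry, so the second error term is at most [2 p], below [12 p].

    All series are truncated at a rank [M]: the event [N > M] has probability
    [(1 - p) ^ M], which tends to [0] at the very end of the proof. *)

(** * Distribution functions of probabilities with a continuous density *)

Section distribution_function.
Context (R : realType) (P : probability (measurableTypeR R) R).

Definition rcdf (x : R) : R := fine (P `]-oo, x]%classic).

(* Exhibits [P] as the law of a random variable, namely the identity. *)
Let idR : measurableTypeR R -> R := idfun.

#[local] HB.instance Definition _ :=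
  @isMeasurableFun.Build _ _ _ _ idR (@measurable_id _ _ setT).

Lemma rcdfE x : (rcdf x)%:E = P `]-oo, x]%classic.
Proof. by rewrite fineK// fin_num_measure. Qed.

Lemma rcdf_ge0 x : 0 <= rcdf x.
Proof. by rewrite -lee_fin rcdfE measure_ge0. Qed.

Lemma rcdf_le1 x : rcdf x <= 1.
Proof. by rewrite -lee_fin rcdfE probability_le1. Qed.

Lemma le_rcdf x y : x <= y -> rcdf x <= rcdf y.
Proof.
by move=> xy; rewrite -lee_fin !rcdfE le_measure ?inE//; exact: subitvPr.
Qed.

Lemma rcdf_cvgy : rcdf x @[x --> +oo] --> (1 : R).
Proof. by have /fine_cvgP[] := cvg_cdfy1 (idR : {RV P >-> R}). Qed.

Lemma rcdf_cvgNy : rcdf x @[x --> -oo] --> (0 : R).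
Proof. by have /fine_cvgP[] := cvg_cdfNy0 (idR : {RV P >-> R}). Qed.

Variable f : R -> R.
Hypotheses (f_cont : continuous f) (f_ge0 : forall x, 0 <= f x).
Hypothesis Pf : forall x,
  (P `]-oo, x]%classic = \int[lebesgue_measure]_(t in `]-oo, x]) (f t)%:E)%E.

Lemma is_derive_rcdf (x : R) : is_derive x (1 : R) rcdf (f x).
Proof.
have mf A : measurable_fun A f.
  by apply: measurable_funTS; exact: continuous_measurable_fun.
have intf : lebesgue_measure.-integrable `]-oo, x + 1] (EFin \o f).
  apply/integrableP; split; first by apply/measurable_EFinP; exact: mf.
  under eq_integral do rewrite /= ger0_norm//.
  by rewrite -Pf (le_lt_trans (probability_le1 _ _)) ?ltry.
have rcdfI : rcdf = fun y => \int[lebesgue_measure]_(t in `]-oo, y]) f t.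
  by apply/funext => y; rewrite /rcdf Pf.
have [|drv dF] := continuous_FTC1 _ intf (ltNyr _) (f_cont (x := x)).
  by rewrite ltrDl.
by rewrite rcdfI; apply: DeriveDef => //; rewrite -derive1E.
Qed.

Hypothesis f_even : forall x, f (- x) = f x.

(** The sum of the values at [x] and [- x] has derivative [f x - f (- x) = 0],
    and it tends to [1] at [+oo]. *)
Lemma rcdfN x : rcdf (- x) = 1 - rcdf x.
Proof.
pose S y := rcdf y + rcdf (- y).
have dS (y : R) : is_derive y (1 : R) S 0.
  have df := is_derive_rcdf y; have dfN := is_derive_rcdf (- y).
  have dN := is_derive1_comp dfN (is_deriveN (is_derive_id y 1)).
  apply: (is_derive_eq (is_deriveD df dN)).
  by rewrite /= f_even mulrN1 subrr.
have SE y : S y = S x by apply: is_derive_0_is_cst.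
have S1 : S y @[y --> +oo] --> (1 + 0 : R).
  apply: cvgD; first exact: rcdf_cvgy.
  have /cvgNy_compNP := rcdf_cvgNy; exact.
have S2 : S y @[y --> +oo] --> S x.
  rewrite (_ : S = cst (S x)); first exact: cvg_cst.
  by apply/funext => y; exact: SE.
have := cvg_unique _ S1 S2; rewrite addr0 => /(_ (@Rhausdorff R)) S1E.
by rewrite S1E /S addrC addKr.
Qed.

End distribution_function.

(** * Monotonicity from derivatives *)

Section derivative_tools.
Context (R : realType).
Implicit Types (f df : R -> R) (a b : R).

Lemma is_derive_MVT f df a b : a <= b ->
  (forall x, a <= x <= b -> is_derive x (1 : R) f (df x)) ->
  exists2 c : R, a <= c <= b & f b - f a = df c * (b - a).
Proof.
move=> ab dfx; have [||c] := @MVT_segment R f df a b ab.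
- by move=> x; rewrite in_itv/= => /andP[ax xb]; apply: dfx; rewrite !ltW.
- apply: derivable_within_continuous => x; rewrite in_itv/= => xab.
  by have [] := dfx _ xab.
by rewrite in_itv/= => cab fE; exists c.
Qed.

Lemma is_derive_le f df a b : a <= b ->
  (forall x, a <= x <= b -> is_derive x (1 : R) f (df x)) ->
  (forall x, a <= x <= b -> 0 <= df x) -> f a <= f b.
Proof.
move=> ab dfx df0; have [c cab fE] := is_derive_MVT ab dfx.
by rewrite -subr_ge0 fE mulr_ge0 ?df0// subr_ge0.
Qed.

End derivative_tools.

(** * The standard normal and Laplace distribution functions *)

Section normal_laplace.
Context (R : realType).

Definition Phi : R -> R := rcdf (normal_prob (0 : R) 1).

Definition phi (x : R) : R := normal_pdf 0 1 x.

Lemma phiE (x : R) : phi x = normal_peak 1 * expR (- x ^+ 2 / 2).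
Proof.
rewrite /phi normal_pdfE ?oner_eq0// /normal_fun subr0.
by rewrite expr1n mulr2n.
Qed.

Lemma is_derive_Phi (x : R) : is_derive x (1 : R) Phi (phi x).
Proof.
apply: is_derive_rcdf => //.
- by apply: continuous_normal_pdf; rewrite oner_eq0.
- exact: normal_pdf_ge0.
Qed.

Lemma PhiN (x : R) : Phi (- x) = 1 - Phi x.
Proof.
apply: (@rcdfN _ _ phi) => //.
- by apply: continuous_normal_pdf; rewrite oner_eq0.
- exact: normal_pdf_ge0.
- by move=> y; rewrite !phiE sqrrN.
Qed.

Lemma continuous_Phi : continuous Phi.
Proof.
move=> x; have [d _] := is_derive_Phi x.
exact/differentiable_continuous/derivable1_diffP.
Qed.

Lemma cvg_Phiy (f : R -> R) F {FF : ProperFilter F} :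
  f x @[x --> F] --> +oo -> Phi (f x) @[x --> F] --> (1 : R).
Proof. by move=> fy; apply: (cvg_comp f Phi fy); exact: rcdf_cvgy. Qed.

Lemma cvg_PhiNy (f : R -> R) F {FF : ProperFilter F} :
  f x @[x --> F] --> -oo -> Phi (f x) @[x --> F] --> (0 : R).
Proof. by move=> fy; apply: (cvg_comp f Phi fy); exact: rcdf_cvgNy. Qed.

Section laplace.
Variable b : R.
Hypothesis b_gt0 : 0 < b.

Lemma laplace_cdfN (x : R) :
  rcdf (laplace_prob 0 b) (- x) = 1 - rcdf (laplace_prob 0 b) x.
Proof.
apply: (@rcdfN _ _ (laplace_pdf 0 b)) => //.
- exact: continuous_laplace_pdf.
- exact: laplace_pdf_ge0.
- by move=> y; rewrite /laplace_pdf b_gt0 !subr0 normrN.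
Qed.

(** On the positive half-line the density is [e^-(y/b) / (2 b)], which makes [S]
    constant there, and [S] tends to [1] at [+oo]. *)
Lemma laplace_cdfE (x : R) : 0 < x ->
  rcdf (laplace_prob 0 b) x = 1 - expR (- x / b) / 2.
Proof.
move=> x0; pose S y := rcdf (laplace_prob 0 b) y + expR (- y / b) / 2.
have dS (y : R) : x <= y -> is_derive y (1 : R) S 0.
  move=> xy.
  have dL : is_derive y (1 : R) (rcdf (laplace_prob 0 b)) (laplace_pdf 0 b y).
    apply: is_derive_rcdf => //.
      exact: continuous_laplace_pdf.
    exact: laplace_pdf_ge0.
  have dI : is_derive y (1 : R) (fun y : R => - y / b) (- b^-1).
    by apply: is_derive_eq; rewrite /GRing.scale /= ?mulr0 ?add0r; ring.
  have dE := is_derive1_comp (is_derive_expR _) dI.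
  have : is_derive y (1 : R) S
      (laplace_pdf 0 b y + 2^-1 *: (expR (- y / b) * - b^-1)).
    apply: is_deriveD.
    rewrite (_ : (fun y => _) = 2^-1 \*: (expR \o (fun y => - y / b))).
      exact: is_deriveZ.
    by apply/funext => z /=; rewrite mulrC.
  move=> /is_derive_eq; apply.
  rewrite /laplace_pdf b_gt0 subr0 ger0_norm ?(le_trans (ltW x0))//.
  by rewrite /GRing.scale/= invfM; ring.
have SE y : x <= y -> S y = S x.
  move=> xy; have [z /andP[xz _]|c _] := @is_derive_MVT _ S (cst 0) _ _ xy.
    exact: dS.
  by rewrite /= mul0r => /eqP; rewrite subr_eq0 => /eqP.
have S1 : S y @[y --> +oo] --> (1 + 0 / 2 : R).
  apply: cvgD; first exact: rcdf_cvgy.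
  have yb : y / b @[y --> +oo] --> +oo.
    by apply: gt0_cvgMly; rewrite ?invr_gt0//; exact: cvg_id.
  apply: cvgMl; have : expR (- (y / b)) @[y --> +oo] --> (0 : R).
    apply: (cvg_comp (fun y => y / b) (fun y => expR (- y)) yb).
    exact: cvgr_expR.
  by under eq_cvg do rewrite -mulNr.
have S2 : S y @[y --> +oo] --> S x.
  apply: cvg_near_cst; near=> y; apply: SE; near: y.
  exact: nbhs_pinfty_ge (num_real x).
have := cvg_unique _ S1 S2; rewrite mul0r addr0 => /(_ (@Rhausdorff R)) S1E.
apply/esym/eqP; rewrite subr_eq; apply/eqP; exact: S1E.
Unshelve. all: by end_near. Qed.

End laplace.

End normal_laplace.
Arguments Phi {R} x.

(** * An exponential mixture of normal laws *)

Section gaussian_exponent.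
Context (R : realType).

Lemma is_derive_expR_Nsqr (s : R) :
  is_derive s (1 : R) (fun s => expR (- s ^+ 2))
    (expR (- s ^+ 2) * (- (2 * s))).
Proof.
apply: (@is_derive1_comp _ expR (fun s => - s ^+ 2)).
by apply: is_derive_eq; rewrite /GRing.scale/=; ring.
Qed.

Lemma cvg_expR_Nsqr0 : expR (- s ^+ 2) @[s --> (0 : R)^'+] --> (1 : R).
Proof.
have -> : (1 : R) = expR (- 0 ^+ 2) by rewrite expr0n/= oppr0 expR0.
apply: cvg_at_right_filter; apply: continuous_comp; last exact: continuous_expR.
by apply: (@continuousN _ R^o); exact: exprn_continuous.
Qed.

End gaussian_exponent.

Section exponential_mixture.
Context (R : realType) (a : R).
Hypothesis a_gt0 : 0 < a.
Notation c := (Num.sqrt (2 : R)).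

(** A primitive of [2 s e^(-s^2) Phi (a / s)], that is, of
    [e^-t Phi (a / sqrt t)] after the substitution [t = s^2].  The bracket is,
    up to the factor [e^-(sqrt 2 a)], an inverse Gaussian distribution
    function. *)
Definition mixprim (s : R) : R :=
  - expR (- s ^+ 2) * Phi (a / s)
  - 2^-1 * (expR (- (c * a)) * Phi (c * s - a / s)
            + expR (c * a) * Phi (- (c * s + a / s))).

(** Completing the square shows that the three normal densities produced by the
    differentiation all equal [e^(-s^2) phi (a / s)] up to the exponential
    factor in front of them, so their contributions cancel. *)
Lemma is_derive_mixprim (s : R) : 0 < s ->
  is_derive s (1 : R) mixprim (2 * s * expR (- s ^+ 2) * Phi (a / s)).
Proof.
move=> s0; have sN0 : s != 0 by rewrite gt_eqF.
have c2 : c ^+ 2 = 2 by rewrite sqr_sqrtr.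
have dV : is_derive s (1 : R) (fun s : R => a / s) (- (a / s ^+ 2)).
  have dI : is_derive s (1 : R) (fun s : R => s^-1) (- s ^- 2 *: 1).
    by apply: (@is_deriveV _ id).
  have := is_deriveZ a dI; rewrite (_ : a \*: _ = (fun s => a / s))//.
  by move=> /is_derive_eq; apply; rewrite /GRing.scale/=; ring.
have dE := is_derive_expR_Nsqr s.
have dP (f : R -> R) df : is_derive s (1 : R) f df ->
    is_derive s (1 : R) (Phi \o f) (phi (f s) * df).
  by move=> ?; apply: is_derive1_comp; exact: is_derive_Phi.
have dl : is_derive s (1 : R) (fun s => c * s) c.
  by apply: is_derive_eq; rewrite /GRing.scale/=; ring.
have d1 := is_deriveM (is_deriveN dE) (dP _ _ dV).
have d2 := is_deriveZ (expR (- (c * a))) (dP _ _ (is_deriveB dl dV)).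
have d3 := is_deriveZ (expR (c * a)) (dP _ _ (is_deriveN (is_deriveD dl dV))).
have d4 := is_deriveB d1 (is_deriveZ 2^-1 (is_deriveD d2 d3)).
apply: (is_derive_eq d4).
rewrite /GRing.scale/=.
have e1 : expR (- (c * a)) * phi (c * s - a / s)
          = expR (- s ^+ 2) * phi (a / s).
  rewrite !phiE !(mulrCA _ (normal_peak 1)) -!expRD; congr (_ * expR _).
  rewrite (_ : - (c * s - a / s) ^+ 2
               = - c ^+ 2 * s ^+ 2 + 2 * c * a  - (a / s) ^+ 2).
    by rewrite c2; field.
  by field.
have e2 : expR (c * a) * phi (- (c * s + a / s))
          = expR (- s ^+ 2) * phi (a / s).
  rewrite !phiE !(mulrCA _ (normal_peak 1)) -!expRD; congr (_ * expR _).
  rewrite (_ : - (- (c * s + a / s)) ^+ 2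
               = - c ^+ 2 * s ^+ 2 - 2 * c * a  - (a / s) ^+ 2).
    by rewrite c2; field.
  by field.
rewrite !fctE /= !mulrA e1 e2.
by field.
Qed.

(** With [k] one of the bounds of the decreasing function [x |-> Phi (a / x)] on
    the segment, [mixprim x + k e^(-x^2)] is monotone there: its derivative is
    [2 x e^(-x^2) (Phi (a / x) - k)]. *)
Lemma mixprim_step (s t : R) : 0 < s -> s <= t ->
  Phi (a / t) * (expR (- s ^+ 2) - expR (- t ^+ 2)) <= mixprim t - mixprim s
    <= Phi (a / s) * (expR (- s ^+ 2) - expR (- t ^+ 2)).
Proof.
move=> s0 st.
have dK (k : R) (x : R) : s <= x <= t ->
    is_derive x (1 : R) (fun x => mixprim x + k * expR (- x ^+ 2))
      (2 * x * expR (- x ^+ 2) * (Phi (a / x) - k)).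
  move=> /andP[sx _].
  have dE := is_derive_expR_Nsqr x.
  have dM := is_derive_mixprim (lt_le_trans s0 sx).
  apply: (is_derive_eq (is_deriveD dM (is_deriveZ k dE))).
  by rewrite /GRing.scale/=; ring.
have Phi_anti x y : s <= x -> x <= y -> Phi (a / y) <= Phi (a / x).
  move=> sx xy; have x0 := lt_le_trans s0 sx.
  apply: le_rcdf; rewrite ler_pM2l// lef_pV2// posrE //.
  exact: lt_le_trans xy.
apply/andP; split.
- have := is_derive_le st (dK (Phi (a / t))) _.
  suff h x : s <= x <= t ->
      0 <= 2 * x * expR (- x ^+ 2) * (Phi (a / x) - Phi (a / t)).
    by move=> /(_ h); lra.
  move=> /andP[sx xt]; rewrite !mulr_ge0 ?expR_ge0//.
    by rewrite (le_trans _ sx)// ltW.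
  by rewrite subr_ge0 Phi_anti.
- have dK' x : s <= x <= t -> is_derive x (1 : R)
      (- (fun x => mixprim x + Phi (a / s) * expR (- x ^+ 2)))
      (- (2 * x * expR (- x ^+ 2) * (Phi (a / x) - Phi (a / s)))).
    by move=> xst; exact: (is_deriveN (dK (Phi (a / s)) x xst)).
  have := is_derive_le st dK' _.
  suff h x : s <= x <= t ->
      0 <= - (2 * x * expR (- x ^+ 2) * (Phi (a / x) - Phi (a / s))).
    by move=> /(_ h); rewrite !fctE; lra.
  move=> /andP[sx xt]; rewrite -mulrN !mulr_ge0 ?expR_ge0//.
    by rewrite (le_trans _ sx)// ltW.
  by rewrite opprB subr_ge0 Phi_anti.
Qed.

Lemma cvg_mixprim0 : mixprim s @[s --> 0^'+] --> (-1 : R).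
Proof.
have ay : a / s @[s --> (0 : R)^'+] --> +oo.
  apply: gt0_cvgMry => //; apply/cvgrVy.
    exact: nbhs_right_gt.
  exact: cvg_at_right_filter.
have aNy : - (a / s) @[s --> (0 : R)^'+] --> -oo by apply/cvgNrNy.
have cNy : c * s - a / s @[s --> (0 : R)^'+] --> -oo.
  apply: (@ler_cvgNy _ _ _ _ (fun s => c + - (a / s))); last first.
    by apply: (cvg_comp _ (fun x => c + x) aNy); exact: cvg_addrl_Ny.
  near=> s; rewrite lerD2r ler_piMr ?sqrtr_ge0//.
  by near: s; exact: nbhs_right_le.
have cNy' : - (c * s + a / s) @[s --> (0 : R)^'+] --> -oo.
  apply: (@ler_cvgNy _ _ _ _ (fun s => - (a / s))) => //.
  near=> s; rewrite lerN2 lerDr mulr_ge0 ?sqrtr_ge0//.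
have -> : (-1 : R) = - 1 * 1 - 2^-1 * (expR (- (c * a)) * 0 + expR (c * a) * 0).
  by ring.
apply: cvgB.
  by apply: cvgM; [apply: cvgN; exact: cvg_expR_Nsqr0|exact: cvg_Phiy].
apply: cvgMr; apply: cvgD; apply: cvgMr; exact: cvg_PhiNy.
Unshelve. all: by end_near. Qed.

Lemma cvg_mixprimy : mixprim s @[s --> +oo] --> - (expR (- (c * a)) / 2).
Proof.
have c_gt0 : 0 < c by rewrite sqrtr_gt0.
have cy : c * s @[s --> +oo] --> +oo by apply: gt0_cvgMry => //; exact: cvg_id.
have cyP : c * s - a / s @[s --> +oo] --> +oo.
  apply: (@ger_cvgy _ _ _ _ (fun s => c * s + - 1)).
    near=> s; rewrite lerD2l lerN2 ler_pdivrMr ?mul1r.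
      by near: s; apply: nbhs_pinfty_ge; exact: num_real.
    by near: s; apply: nbhs_pinfty_gt; exact: num_real.
  by apply: (cvg_comp _ (fun x => x + -1) cy); exact: cvg_addrr.
have cNy : - (c * s + a / s) @[s --> +oo] --> -oo.
  apply/cvgNrNy; apply: ger_cvgy cy.
  near=> s; rewrite lerDl divr_ge0 ?(ltW a_gt0)//.
have a0 : a / s @[s --> +oo] --> a * 0.
  apply: cvgMr; apply/gtr0_cvgV0; last exact: cvg_id.
  by near=> s.
have E0 : expR (- s ^+ 2) @[s --> +oo] --> (0 : R).
  apply: (cvg_comp (fun s => s ^+ 2) (fun y => expR (- y)) (@cvgr_expr2 R)).
  exact: cvgr_expR.
have -> : - (expR (- (c * a)) / 2) = - 0 * Phi (a * 0)
    - 2^-1 * (expR (- (c * a)) * 1 + expR (c * a) * 0).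
  by ring.
apply: cvgB.
  apply: cvgM; first exact: cvgN.
  by apply: (cvg_comp _ Phi a0); exact: continuous_Phi.
apply: cvgMr; apply: cvgD; apply: cvgMr; [exact: cvg_Phiy|exact: cvg_PhiNy].
Unshelve. all: by end_near. Qed.

(** The limit of [mixprim_step] when the left end of the segment tends to
    [0]. *)
Lemma mixprim_init (t : R) : 0 < t ->
  Phi (a / t) * (1 - expR (- t ^+ 2)) <= mixprim t + 1 <= 1 - expR (- t ^+ 2).
Proof.
move=> t0.
have m0 : mixprim t - mixprim s @[s --> 0^'+] --> (mixprim t - -1 : R).
  by apply: cvgB; [exact: cvg_cst|exact: cvg_mixprim0].
have e0 : expR (- s ^+ 2) - expR (- t ^+ 2) @[s --> (0 : R)^'+]
    --> (1 - expR (- t ^+ 2) : R).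
  by apply: cvgB; [exact: cvg_expR_Nsqr0|exact: cvg_cst].
have near_le : \forall s \near (0 : R)^'+, 0 < s <= t.
  by near=> s; apply/andP; split=> //; near: s; exact: nbhs_right_le.
have <- : mixprim t - -1 = mixprim t + 1 by rewrite opprK.
apply/andP; split.
- apply: (ler_cvg_to (cvgMr e0) m0); near=> s.
  have /andP[s0 st] : 0 < s <= t by near: s.
  by have /andP[] := mixprim_step s0 st.
- apply: (ler_cvg_to m0 e0); near=> s.
  have /andP[s0 st] : 0 < s <= t by near: s.
  have /andP[_ /le_trans] := mixprim_step s0 st; apply.
  by rewrite ler_piMl ?rcdf_le1// subr_ge0 ler_expR lerN2 ler_sqr ?nnegrE// ltW.
Unshelve. all: by end_near. Qed.

End exponential_mixture.

(** * Sums with geometric weights *)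

Section geometric_sums.
Context (R : realType).
Implicit Types (p q r x : R) (g h : nat -> R).

Lemma sum_geom x M : \sum_(n < M) (1 - x) * x ^+ n = 1 - x ^+ M.
Proof.
elim: M => [|M IH]; first by rewrite big_ord0 expr0 subrr.
by rewrite big_ord_recr/= IH exprS; ring.
Qed.

Lemma sum_geom_le1 x M : 0 <= x -> \sum_(n < M) (1 - x) * x ^+ n <= 1.
Proof. by move=> x0; rewrite sum_geom gerBl exprn_ge0. Qed.

(** With [r = e^-p] one has [1 - p <= r] and [1 - r <= p <= (1 + p) (1 - r)], so
    each difference of weights lies between
    [p (1 - p)^n - (1 + p) (1 - r) r^n] and [p (1 - r) r^n]; both have partial
    sums bounded by [p] in absolute value. *)
Lemma geom_expR_dist p g M : 0 < p < 1 -> (forall n, 0 <= g n <= 1) ->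
  `|\sum_(n < M) p * (1 - p) ^+ n * g n
    - \sum_(n < M) (1 - expR (- p)) * expR (- p) ^+ n * g n| <= p.
Proof.
move=> /andP[p0 p1] g01; set r := expR (- p).
have r0 : 0 < r by exact: expR_gt0.
have qr : 1 - p <= r by exact: expR_ge1Dx.
have pr : p <= (1 + p) * (1 - r).
  have : r * (1 + p) <= 1.
    by rewrite /r expRN ler_pdivrMl ?expR_gt0// mulr1 expR_ge1Dx.
  by lra.
have q0 : 0 < 1 - p by rewrite subr_gt0.
have qrn n : (1 - p) ^+ n <= r ^+ n by rewrite lerXn2r// nnegrE ltW.
have prn n : p * r ^+ n <= (1 + p) * (1 - r) * r ^+ n.
  by rewrite ler_wpM2r// exprn_ge0// ltW.
have qn0 n : 0 <= p * (1 - p) ^+ n by rewrite mulr_ge0 ?exprn_ge0// ltW.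
have rn0 n : 0 <= (1 - r) * r ^+ n.
  rewrite mulr_ge0 ?exprn_ge0 ?(ltW r0)//.
  by rewrite subr_ge0 -expR0 ler_expR oppr_le0 ltW.
have pqr n : p * (1 - p) ^+ n <= p * r ^+ n by rewrite ler_wpM2l// ltW.
rewrite ler_norml -sumrB; apply/andP; split.
- apply: (@le_trans _ _ (\sum_(n < M)
      (p * (1 - p) ^+ n - (1 + p) * ((1 - r) * r ^+ n)))).
    rewrite sumrB -[X in _ <= _ - X]mulr_sumr sum_geom.
    have := sum_geom (1 - p) M; rewrite subKr => ->.
    have := qrn M; have : 0 <= r ^+ M by rewrite exprn_ge0// ltW.
    by move: (r ^+ M) ((1 - p) ^+ M) => u v u0 vu; nra.
  apply: ler_sum => n _; rewrite -mulrBl.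
  have /andP[g0 g1] := g01 n; have B0 := rn0 n.
  have AC : p * (1 - p) ^+ n <= (1 + p) * ((1 - r) * r ^+ n).
    by rewrite mulrA (le_trans (pqr n)).
  move: (p * _) ((1 - r) * _) B0 AC => A B B0 AC.
  by have := mulr_ge0 (ltW p0) B0; nra.
- apply: (@le_trans _ _ (\sum_(n < M) p * ((1 - r) * r ^+ n))).
    apply: ler_sum => n _; rewrite -mulrBl.
    have /andP[g0 g1] := g01 n; have B0 := rn0 n.
    have AC : p * (1 - p) ^+ n <= (1 + p) * ((1 - r) * r ^+ n).
      by rewrite mulrA (le_trans (pqr n)).
    move: (p * _) ((1 - r) * _) B0 AC => A B B0 AC.
    by have := mulr_ge0 (ltW p0) B0; nra.
  by rewrite -mulr_sumr ler_piMr ?(ltW p0)// sum_geom_le1// ltW.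
Qed.

(** The sum is a lower sum for the increments of [h].  The upper sum bounding
    [h M] from above consists of [1 - r], for the first increment, and of [r]
    times the lower sum, hence exceeds the lower sum by at most [1 - r]. *)
Lemma lower_sum_dist r g h M : 0 <= r <= 1 -> (forall n, 0 <= g n <= 1) ->
  h 0 = 0 -> h 1 <= 1 - r ->
  (forall n, (1 - r) * r ^+ n * g n <= h n.+1 - h n) ->
  (forall n, h n.+2 - h n.+1 <= (1 - r) * r ^+ n.+1 * g n) ->
  `|\sum_(n < M) (1 - r) * r ^+ n * g n - h M| <= 1 - r.
Proof.
move=> /andP[r0 r1] g01 h0 h1 hl hu.
have t0 n : 0 <= (1 - r) * r ^+ n * g n.
  have /andP[g0 _] := g01 n.
  by rewrite !mulr_ge0 ?exprn_ge0// subr_ge0.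
have S0 k : 0 <= \sum_(n < k) (1 - r) * r ^+ n * g n by apply: sumr_ge0.
have lo k : \sum_(n < k) (1 - r) * r ^+ n * g n <= h k.
  elim: k => [|k IH]; first by rewrite big_ord0 h0.
  by rewrite big_ord_recr/=; have := hl k; lra.
have up k : h k.+1 <= (1 - r) + \sum_(n < k) (1 - r) * r ^+ n.+1 * g n.
  elim: k => [|k IH]; first by rewrite big_ord0 addr0.
  by rewrite big_ord_recr/=; have := hu k; lra.
rewrite distrC ger0_norm ?subr_ge0//.
case: M => [|M]; first by rewrite h0 big_ord0 subrr subr_ge0.
rewrite lerBlDr (le_trans (up M))// lerD2l big_ord_recr/=.
rewrite -[leLHS]addr0 lerD//; apply: ler_sum => n _.
by rewrite exprS [_ * (r * _)]mulrCA -!mulrA ler_piMl// mulrA.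
Qed.

(** Since [1 / sqrt n <= 2 (sqrt n - sqrt (n - 1))], a summation by parts
    reduces the claim to [E (sqrt N) <= 1 / sqrt p] for [N] geometric, which
    follows from the tangent bound of the square root at the mean [1 / p].  The
    summation by parts is carried out by an induction in which [V] is that
    tangent shifted up by [1 / (2 sqrt p)]. *)
Lemma sum_geom_invsqrt p M : 0 < p < 1 ->
  \sum_(n < M) p * (1 - p) ^+ n / Num.sqrt n.+1%:R <= 2 * Num.sqrt p.
Proof.
move=> /andP[p0 p1]; set w := Num.sqrt p.
have w0 : 0 < w by rewrite sqrtr_gt0.
have w2 : w ^+ 2 = p by rewrite sqr_sqrtr// ltW.
have q0 : 0 < 1 - p by rewrite subr_gt0.
pose u n := Num.sqrt (n%:R : R).
have u0 n : 0 <= u n by exact: sqrtr_ge0.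
have u2 n : u n ^+ 2 = n%:R by rewrite sqr_sqrtr.
(* The tangent of the square root at [1 / p]. *)
have tang n : u n <= w / 2 * n%:R + (2 * w)^-1.
  have : 0 <= (w * u n - 1) ^+ 2 by exact: sqr_ge0.
  rewrite -u2 => h.
  have -> : w / 2 * u n ^+ 2 + (2 * w)^-1 = ((w * u n) ^+ 2 + 1) / (2 * w).
    by field; rewrite gt_eqF.
  by rewrite ler_pdivlMr ?mulr_gt0//; move: h; rewrite sqrrB; nra.
(* [V] solves [(1 - p) V (n + 1) + p (tangent at n + 1) = V n], which makes the
   left-hand side of [pot] nonincreasing in [k]. *)
pose V n := w / 2 * n%:R + w^-1.
have Vu n : u n <= V n.
  rewrite (le_trans (tang n))// lerD2l lef_pV2 ?posrE// ?mulr_gt0//.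
  by rewrite ler_peMl ?ltW// ltr1n.
have pot k : \sum_(n < k) (1 - p) ^+ n * (u n.+1 - u n)
             + (1 - p) ^+ k * (V k - u k) <= w^-1.
  elim: k => [|k]; first by rewrite big_ord0 /V /u mulr0 sqrtr0 expr0; lra.
  apply: le_trans; rewrite big_ord_recr/= -addrA lerD2l exprSr -mulrA -mulrDr.
  rewrite ler_wpM2l ?exprn_ge0 ?(ltW q0)//.
  have := tang k.+1; move=> t.
  have : p * u k.+1 <= p * V k.+1 - w / 2.
    have -> : p * V k.+1 - w / 2 = p * (w / 2 * k.+1%:R + (2 * w)^-1).
      by rewrite /V -w2; field; rewrite gt_eqF.
    by rewrite ler_wpM2l// ltW.
  have -> : V k.+1 = V k + w / 2 by rewrite /V -natr1; ring.
  by lra.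
have inv n : (u n.+1)^-1 <= 2 * (u n.+1 - u n).
  have un0 : 0 < u n.+1 by rewrite sqrtr_gt0 ltr0n.
  have du : (u n.+1 - u n) * (u n.+1 + u n) = 1.
    by rewrite -subr_sqr !u2 -natr1 addrAC subrr add0r.
  have uu : u n <= u n.+1 by rewrite ler_wsqrtr// ler_nat.
  rewrite -[leLHS]mul1r ler_pdivrMr// -[leLHS]du -mulrA mulrCA.
  by rewrite ler_wpM2l ?subr_ge0//; lra.
apply: (@le_trans _ _ (2 * p * \sum_(n < M) (1 - p) ^+ n * (u n.+1 - u n))).
  rewrite mulr_sumr; apply: ler_sum => n _.
  rewrite -[leRHS]mulrA [2 * _]mulrC -!mulrA ler_wpM2l ?(ltW p0)//.
  rewrite ler_wpM2l ?exprn_ge0 ?(ltW q0)//.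
  by rewrite [leRHS]mulrC; exact: inv.
have : \sum_(n < M) (1 - p) ^+ n * (u n.+1 - u n) <= w^-1.
  apply: le_trans (pot M); rewrite lerDl mulr_ge0 ?exprn_ge0 ?(ltW q0)//.
  by rewrite subr_ge0.
have wE : p / w = w by rewrite -w2 expr2 mulfK ?gt_eqF.
by move=> h; rewrite -[X in _ <= 2 * X]wE -mulrA !ler_wpM2l// ltW.
Qed.

End geometric_sums.

(** * Geometric mixtures of normal laws are close to the Laplace law *)

Section mixture_laplace.
Context (R : realType) (p sigma : R).
Hypotheses (p01 : 0 < p < 1) (sigma_gt0 : 0 < sigma).
Notation c := (Num.sqrt (2 : R)).

Let p_gt0 : 0 < p. Proof. by case/andP: p01. Qed.

Definition normal_mix (a : R) M : R :=
  \sum_(n < M) p * (1 - p) ^+ n * Phi (a / Num.sqrt (p * n.+1%:R)).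

Lemma normal_mix_mixprim (a : R) M : 0 < a ->
  `|normal_mix a M.+1 - (mixprim a (Num.sqrt (p * M.+1%:R)) + 1)| <= 2 * p.
Proof.
move=> a0; pose t n := Num.sqrt (p * n%:R).
have t0 n : 0 < t n.+1 by rewrite sqrtr_gt0 mulr_gt0.
have tE n : expR (- t n ^+ 2) = expR (- p) ^+ n.
  by rewrite sqr_sqrtr ?mulr_ge0 ?(ltW p_gt0)// -mulNr expRM_natr.
have tS n : t n.+1 <= t n.+2.
  by rewrite ler_wsqrtr// ler_wpM2l ?(ltW p_gt0)// ler_nat.
pose g n := Phi (a / t n.+1).
(* The primitive shifted by [1] vanishes at [0], by its limit there. *)
pose h n := if n is n'.+1 then mixprim a (t n) + 1 else 0.
have g01 n : 0 <= g n <= 1 by rewrite rcdf_ge0 rcdf_le1.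
have r01 : 0 <= expR (- p) <= 1.
  by rewrite expR_ge0 -expR0 ler_expR oppr_le0 ltW.
have pr : 1 - expR (- p) <= p by have := expR_ge1Dx (- p); lra.
have /(_ M.+1) hg := @lower_sum_dist _ (expR (- p)) g h _ r01 g01 erefl.
have rg := geom_expR_dist M.+1 p01 g01.
have fin := le_trans (ler_distD _ _ _) (lerD rg (le_trans (hg _ _ _) pr)).
rewrite mulr_natl mulr2n; apply: fin.
- by have /andP[_] := mixprim_init a0 (t0 0); rewrite tE expr1.
- move=> [|n]; rewrite /h.
    have /andP[+ _] := mixprim_init a0 (t0 0).
    by rewrite tE expr1 expr0 subr0 mulr1 mulrC.
  have /andP[+ _] := mixprim_step a0 (t0 n) (tS n).
  by rewrite !tE [expR (- p) ^+ n.+2]exprS /g; lra.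
- move=> n; rewrite /h.
  have /andP[_] := mixprim_step a0 (t0 n) (tS n).
  by rewrite !tE [expR (- p) ^+ n.+2]exprS /g; lra.
Qed.

Lemma cvg_sqrt_natMr : Num.sqrt (p * n.+1%:R) @[n --> \oo] --> +oo.
Proof.
apply/cvgryPge => A; near=> n.
rewrite (le_trans (ler_norm A))// -sqrtr_sqr ler_wsqrtr//.
rewrite mulrC -ler_pdivrMr//.
rewrite (@le_trans _ _ n%:R) ?ler_nat//.
by near: n; exact: nbhs_infty_ger.
Unshelve. all: by end_near. Qed.

Lemma normal_mix_laplace_gt0 (z e : R) : 0 < z -> 0 < e ->
  \forall M \near \oo,
    `|normal_mix (z / sigma) M - rcdf (laplace_prob 0 (sigma / c)) z|
      <= 2 * p + e.
Proof.
move=> z0 e0; have a0 : 0 < z / sigma by rewrite divr_gt0.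
have c0 : 0 < c by rewrite sqrtr_gt0.
have sc0 : 0 < sigma / c by rewrite divr_gt0.
have := cvg_comp _ _ cvg_sqrt_natMr (@cvg_mixprimy _ _ a0).
move=> /cvgrPdist_le /(_ _ e0) [M0 _ HM].
exists M0.+1 => // -[//|M] /= MM; have {HM} := HM M MM => /= HM.
have := normal_mix_mixprim M a0.
rewrite laplace_cdfE//.
have -> : - z / (sigma / c) = - (c * (z / sigma)).
  by field; rewrite !gt_eqF.
move: (normal_mix _ _) (mixprim _ _) (expR _) HM => x y w.
rewrite !ler_norml => /andP[h1 h2] /andP[h3 h4].
by apply/andP; split; lra.
Qed.

Lemma normal_mixN (a : R) M :
  normal_mix (- a) M = 1 - (1 - p) ^+ M - normal_mix a M.
Proof.
rewrite -(sum_geom (1 - p)) subKr /normal_mix -sumrB; apply: eq_bigr => n _.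
by rewrite mulNr PhiN; ring.
Qed.

Lemma normal_mix_laplace (z e : R) : 0 < e ->
  \forall M \near \oo,
    `|normal_mix (z / sigma) M - rcdf (laplace_prob 0 (sigma / c)) z|
      <= 2 * p + e.
Proof.
move=> e0.
have c0 : 0 < c by rewrite sqrtr_gt0.
have sc0 : 0 < sigma / c by rewrite divr_gt0.
have e20 : 0 < e / 2 by rewrite divr_gt0.
have : (1 - p) ^+ M @[M --> \oo] --> (0 : R).
  by apply: cvg_expr; case/andP: p01 => p0 p1; rewrite ger0_norm; lra.
move=> /cvgrPdist_le/(_ _ e20) qM.
have [z0|z0|->] := ltgtP z 0; last 2 first.
- exact: normal_mix_laplace_gt0.
- (* Up to the truncation, both sides give mass 1/2 to the half-line. *)
  have L0 := laplace_cdfN sc0 0; have S0 M := normal_mixN 0 M.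
  rewrite oppr0 in L0 S0.
  near=> M; have : `|0 - (1 - p) ^+ M| <= e / 2 by near: M.
  move: L0 (S0 M) p_gt0; rewrite mul0r !ler_norml.
  move: (normal_mix _ _) (rcdf _ _) (_ ^+ _) => x y u yE xE p0 /andP[u1 u2].
  by apply/andP; split; lra.
- have zN : 0 < - z by rewrite oppr_gt0.
  near=> M.
  have h1 : `|normal_mix (- z / sigma) M
              - rcdf (laplace_prob 0 (sigma / c)) (- z)| <= 2 * p + e / 2.
    by near: M; exact: normal_mix_laplace_gt0.
  have h2 : `|0 - (1 - p) ^+ M| <= e / 2 by near: M.
  move: h1 h2; rewrite mulNr normal_mixN laplace_cdfN//.
  rewrite !ler_norml => /andP[? ?] /andP[? ?].
  by apply/andP; split; lra.
Unshelve. all: by end_near. Qed.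

End mixture_laplace.

(** * Truncation, independence and identical distribution *)

Section truncation.
Context d (T : measurableType d) (R : realType) (P : probability T R).

(** The error is the probability of the part of [A] outside the first [M]
    events, at most that of the complement of their union. *)
Lemma fine_prob_truncate (A : set T) (B : nat -> set T) M :
  measurable A -> (forall n, measurable (B n)) -> trivIset setT B ->
  `|fine (P A) - \sum_(n < M) fine (P (B n `&` A))|
    <= 1 - \sum_(n < M) fine (P (B n)).
Proof.
move=> mA mB tB; pose U := \bigcup_(n in `I_M) B n.
have mU : measurable U by apply: bigcup_measurable.
have sumP (F : nat -> set T) :
    (forall n, measurable (F n)) -> trivIset setT F ->
    \sum_(n < M) fine (P (F n)) = fine (P (\bigcup_(n in `I_M) F n)).
  move=> mF tF; rewrite bigcup_mkord measure_bigsetU//.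
  by rewrite sum_fine// => i _; rewrite fin_num_measure.
have AUE : \bigcup_(n in `I_M) (B n `&` A) = A `&` U.
  by rewrite setIC /U setI_bigcupl.
have mBA n : measurable (B n `&` A) by exact: measurableI.
have tBA : trivIset setT (fun n => B n `&` A) by exact: trivIset_setIr.
rewrite (sumP _ mBA tBA) AUE (sumP _ mB tB).
have <- : fine (P (~` U)) = 1 - fine (P U).
  by rewrite probability_setC// fineB// fin_num_measure.
have PA : P A = (P (A `\` U) + P (A `&` U))%E by exact: measureDI.
have mD : measurable (A `\` U) by exact: measurableD.
have mI : measurable (A `&` U) by exact: measurableI.
have mC : measurable (~` U) by exact: measurableC.
rewrite PA fineD ?fin_num_measure// addrK ger0_norm ?fine_ge0//.
rewrite fine_le ?fin_num_measure//.
by rewrite le_measure ?inE// => x [].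
Qed.

End truncation.

Section independence_transfer.
Context d (T : measurableType d) (R : realType) (P : probability T R).

(** Each [X j] is measurable for the sigma-algebra generated by the sequence,
    hence so are the partial sums. *)
Lemma sequence_sum_event (X : nat -> {RV P >-> R}) n (B : set R) :
  measurable B ->
  <<s \bigcup_j g_sigma_algebra_preimage (X j) >>
    ((fun w => \sum_(j < n) X j w) @^-1` B).
Proof.
move=> mB; set G := \bigcup_j g_sigma_algebra_preimage (X j).
have mX (j : 'I_n) : measurable_fun setT (X j : g_sigma_algebraType G -> R).
  move=> _ C mC; apply: sub_sigma_algebra; exists (nat_of_ord j) => //.
  by exists C.
have := @measurable_sum _ (g_sigma_algebraType G) R setT _ (index_enum 'I_n)
  (fun j w => X j w) mX measurableT B mB.
by rewrite setTI.
Qed.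

(** The product rule over a subset of ['I_n] is the product rule over its image
    in [nat], the family of sets being completed by full sets. *)
Lemma mutually_independent_ord (X : nat -> {RV P >-> R}) n :
  mutually_independent X ->
  mutually_independent (fun j : 'I_n => X j).
Proof.
move=> iX J B mB.
pose B' k := if insub k is Some j then B (j : 'I_n) else setT.
have mB' k : measurable (B' k).
  by rewrite /B'; case: insub => [j|]; [exact: mB|exact: measurableT].
have B'E (j : 'I_n) : B' j = B j by rewrite /B' valK.
pose J' := [fset nat_of_ord j | j in J]%fset.
transitivity (P (\bigcap_(i in [set` J']) (X i @^-1` B' i))).
  congr (P _); apply/seteqP; split => w Hw k /=.
    by move=> /imfsetP[j /= jJ ->]; rewrite B'E; exact: Hw.
  by move=> kJ; rewrite -B'E; apply: Hw; apply/imfsetP; exists k.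
rewrite iX// big_imfset/=; last by move=> i j _ _ /val_inj.
by apply: eq_bigr => j _; rewrite B'E.
Qed.

Section identical.
Variables (I : Type) (X : I -> {RV P >-> R}).
Hypothesis hX : identically_distributed X.

Lemma ge0_integral_identically_distributed i j (f : R -> \bar R) :
  measurable_fun setT f -> (forall x, 0 <= f x)%E ->
  (\int[P]_w f (X i w) = \int[P]_w f (X j w))%E.
Proof.
move=> mf f0.
transitivity (\int[distribution P (X i)]_y f y)%E.
  by rewrite ge0_integral_distribution.
transitivity (\int[distribution P (X j)]_y f y)%E.
  by apply: eq_measure_integral => A mA _; exact: hX.
by rewrite ge0_integral_distribution.
Qed.

(** Nonnegative integrals transfer to the distribution unconditionally, hence
    the split into positive and negative parts. *)
Lemma expectation_identically_distributed i j (f : R -> R) :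
  measurable_fun setT f ->
  ('E_P[fun w => f (X i w)] = 'E_P[fun w => f (X j w)])%E.
Proof.
move=> mf; rewrite unlock [LHS]integralE [RHS]integralE.
have mfE : measurable_fun setT (EFin \o f) by exact/measurable_EFinP.
have posE k :
    ((fun w => (f (X k w))%:E)^\+ = (fun w => (EFin \o f)^\+ (X k w)))%E.
  by apply/funext => w; rewrite !funeposE.
have negE k :
    ((fun w => (f (X k w))%:E)^\- = (fun w => (EFin \o f)^\- (X k w)))%E.
  by apply/funext => w; rewrite !funenegE.
rewrite !posE !negE; congr (_ - _)%E.
- exact: (ge0_integral_identically_distributed i j
    (measurable_funepos mfE) (funepos_ge0 _)).
- exact: (ge0_integral_identically_distributed i j
    (measurable_funeneg mfE) (funeneg_ge0 _)).
Qed.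

End identical.

End independence_transfer.

(** * Berry-Esseen for the summands and conclusion *)

Lemma berry_esseen_iid (R : realType) (C : R) (hC : berry_esseen_constant C)
    d (T : measurableType d) (P : probability T R) (X : nat -> {RV P >-> R})
    (sigma xi : R) (hX_indep : mutually_independent X)
    (hX_id : identically_distributed X) (hX_mean : ('E_P[X 0%N] = 0)%E)
    (sigma_gt0 : 0 < sigma)
    (hsigma : ('E_P[fun w => (X 0%N w ^+ 2)%R] = (sigma ^+ 2)%:E)%E)
    (hxi : ('E_P[fun w => (`|X 0%N w| ^+ 3)%R] = xi%:E)%E) n (x : R) :
  (0 < n)%N ->
  `|fine (P [set w | \sum_(j < n) X j w <= sigma * Num.sqrt n%:R * x]) - Phi x|
    <= C * xi / sigma ^+ 3 / Num.sqrt n%:R.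
Proof.
move=> n0; pose Y (j : 'I_n) : {RV P >-> R} := X j.
have transfer := expectation_identically_distributed hX_id.
have mean j : ('E_P[Y j] = 0)%E.
  by rewrite -hX_mean; exact: (transfer j 0%N id).
have second j : ('E_P[fun w => (Y j w ^+ 2)%R] = (sigma ^+ 2)%:E)%E.
  rewrite -hsigma; apply: (transfer j 0%N (fun y => y ^+ 2)).
  exact: measurable_funX.
have third j : ('E_P[fun w => (`|Y j w| ^+ 3)%R] = xi%:E)%E.
  rewrite -hxi; apply: (transfer j 0%N (fun y => `|y| ^+ 3)).
  by apply: measurable_funX; exact: normr_measurable.
have second_gt0 j : (0 < 'E_P[fun w => (Y j w ^+ 2)%R])%E.
  by rewrite second lte_fin exprn_gt0.
have third_fin j : ('E_P[fun w => (`|Y j w| ^+ 3)%R] < +oo)%E.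
  by rewrite third ltry.
have := hC d T P n Y n0 (mutually_independent_ord (n := n) hX_indep)
  mean second_gt0 third_fin.
have -> : \sum_j fine ('E_P[fun w => (Y j w ^+ 2)%R])%E = n%:R * sigma ^+ 2.
  under eq_bigr do rewrite second /=.
  by rewrite sumr_const card_ord mulr_natl.
have -> : \sum_j fine ('E_P[fun w => (`|Y j w| ^+ 3)%R])%E = n%:R * xi.
  under eq_bigr do rewrite third /=.
  by rewrite sumr_const card_ord mulr_natl.
have -> : Num.sqrt (n%:R * sigma ^+ 2) = sigma * Num.sqrt n%:R.
  by rewrite sqrtrM// sqrtr_sqr gtr0_norm// mulrC.
set B := sigma * Num.sqrt n%:R => /=.
have rn0 : 0 < Num.sqrt n%:R :> R by rewrite sqrtr_gt0 ltr0n.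
have B0 : 0 < B by rewrite mulr_gt0.
move=> BE.
have ubound y : range _ y -> (y <= _)%E :=
  fun h => le_trans (ereal_sup_ubound h) BE.
have {ubound} := ubound _ (imageT _ x).
have SE : (distribution P
      (B^-1 \o* (\sum_j (Y j : {mfun T >-> R}) : {mfun T >-> R}))%R
      `]-oo, x]%classic
    = P [set w | (\sum_(j < n) X j w <= B * x)%R])%E.
  rewrite /distribution /pushforward; congr (P _); apply/seteqP; split => w/=.
    by rewrite in_itv/= mfun_sum ler_pdivrMr// mulrC.
  by rewrite in_itv/= mfun_sum ler_pdivrMr// mulrC.
have Sfin : P [set w | (\sum_(j < n) X j w <= B * x)%R] \is a fin_num.
  by rewrite -SE fin_num_measure.
rewrite SE -(rcdfE (normal_prob 0 1)) -(fineK Sfin) -EFinB abse_EFin lee_fin.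
move=> /le_trans; apply; rewrite le_eqVlt; apply/orP; left; apply/eqP.
rewrite /B -[in n%:R * xi](@sqr_sqrtr _ n%:R)//.
by field; rewrite !gt_eqF.
Qed.

Theorem theorem3p4 (R : realType) (C_K : R) (hC_K : berry_esseen_constant C_K)
    (d : measure_display) (T : measurableType d) (P : probability T R)
    (X : nat -> {RV P >-> R}) (N : {RV P >-> nat}) (sigma xi p : R)
    (hX_indep : mutually_independent X)
    (hX_id : identically_distributed X)
    (hX_mean : ('E_P[X 0%N] = 0)%E)
    (hsigma_gt0 : 0 < sigma)
    (hsigma : ('E_P[fun w => (X 0%N w ^+ 2)%R] = (sigma ^+ 2)%:E)%E)
    (hxi : ('E_P[fun w => (`|X 0%N w| ^+ 3)%R] = xi%:E)%E)
    (hp : 0 < p < 1)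
    (hN_indep : independent_of_sequence N X)
    (hN_geometric : forall n : nat, (1 <= n)%N ->
      P (N @^-1` [set n]) = (p * (1 - p) ^+ n.-1)%R%:E) :
  (kolmogorov_dist
     (distribution P (Num.sqrt p \o* random_sum N X)%R)
     (laplace_prob 0 (sigma / Num.sqrt 2)%R)
   <= (2 * C_K * xi / sigma ^+ 3 * Num.sqrt p + 12 * p)%R%:E)%E.
Proof.
have [p0 p1] := andP hp; have w0 : 0 < Num.sqrt p by rewrite sqrtr_gt0.
have BE := berry_esseen_iid hC_K hX_indep hX_id hX_mean hsigma_gt0 hsigma hxi.
pose K := C_K * xi / sigma ^+ 3.
(* One summand: a distance is bounded by [K]. *)
have K0 : 0 <= K.
  by have := le_trans (normr_ge0 _) (@BE 1%N 0 isT); rewrite sqrtr1 divr1.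
apply: ge_ereal_sup => _ [z _ <-].
pose A : set T := [set w | Num.sqrt p * random_sum N X w <= z].
have mA : measurable A.
  rewrite (_ : A = random_sum N X @^-1` `]-oo, z / Num.sqrt p]).
    exact: measurable_funPTI.
  by apply/seteqP; split => w; rewrite /A/= in_itv/= ler_pdivlMr// mulrC.
rewrite (_ : distribution _ _ _ = P A); last first.
  rewrite /distribution /pushforward; congr (P _).
  by apply/seteqP; split => w; rewrite /A/= in_itv/= mulrC.
rewrite -(rcdfE (laplace_prob _ _)) -(fineK (fin_num_measure P _ mA)).
rewrite -EFinB abse_EFin lee_fin.
pose B n : set T := N @^-1` [set n.+1].
have mB n : measurable (B n) by exact: measurable_funPTI.
have tB : trivIset setT B.
  by move=> i j _ _ [w [/= Ni]]; rewrite /B/= Ni => -[].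
have PB n : fine (P (B n)) = p * (1 - p) ^+ n by rewrite hN_geometric.
(* Where the Berry-Esseen inequality for [n + 1] summands is applied. *)
pose y n := z / sigma / Num.sqrt (p * n.+1%:R).
have PBA n : fine (P (B n `&` A)) = p * (1 - p) ^+ n *
    fine (P [set w | \sum_(j < n.+1) X j w <= sigma * Num.sqrt n.+1%:R * y n]).
  have -> : sigma * Num.sqrt n.+1%:R * y n = z / Num.sqrt p.
    rewrite /y sqrtrM ?ltW//; field.
    by rewrite !gt_eqF// sqrtr_gt0 ltr0n.
  have msum : <<s \bigcup_j g_sigma_algebra_preimage (X j) >>
      [set w | \sum_(j < n.+1) X j w <= z / Num.sqrt p].
    have := @sequence_sum_event _ _ _ P X n.+1 `]-oo, z / Num.sqrt p]
      (measurable_itv _).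
    by congr (<<s _ >> _); apply/seteqP; split => w; rewrite /= in_itv.
  rewrite -PB -fineM ?fin_num_measure//; last first.
    rewrite (_ : mkset _ =
      (\sum_(j < n.+1) (X j : {mfun T >-> R}) : {mfun T >-> R})
        @^-1` `]-oo, z / Num.sqrt p]); first exact: measurable_funPTI.
    by apply/seteqP; split => w; rewrite /= in_itv/= mfun_sum.
  rewrite -hN_indep//; last by exists [set n.+1] => //; rewrite setTI.
  congr (fine (P _)); apply/seteqP; split => w [Nw].
    by rewrite /A/= /random_sum Nw ler_pdivlMr// mulrC.
  by rewrite /A/= /random_sum Nw ler_pdivlMr// mulrC.
apply/ler_addgt0Pr => e e0; have e20 : 0 < e / 2 by rewrite divr_gt0.
have /cvgrPdist_le/(_ _ e20) qM : (1 - p) ^+ M @[M --> \oo] --> (0 : R).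
  by apply: cvg_expr; rewrite ger0_norm; lra.
near \oo => M.
have h1 : `|0 - (1 - p) ^+ M| <= e / 2 by near: M.
have h2 : `|normal_mix p (z / sigma) M
            - rcdf (laplace_prob 0 (sigma / Num.sqrt 2)) z| <= 2 * p + e / 2.
  by near: M; exact: normal_mix_laplace.
have h3 := fine_prob_truncate P M mA mB tB.
have h4 : `|\sum_(n < M) fine (P (B n `&` A)) - normal_mix p (z / sigma) M|
    <= 2 * K * Num.sqrt p.
  rewrite -sumrB; apply: le_trans (ler_norm_sum _ _ _) _.
  rewrite -mulrA mulrCA; apply: le_trans (ler_wpM2l K0 (sum_geom_invsqrt M hp)).
  rewrite mulr_sumr; apply: ler_sum => n _.
  have pq0 : 0 <= p * (1 - p) ^+ n.
    by rewrite mulr_ge0 ?exprn_ge0 ?subr_ge0 ?ltW.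
  rewrite PBA -mulrBr normrM (ger0_norm pq0) [leRHS]mulrCA ler_wpM2l//.
  exact: BE.
have PBM : \sum_(n < M) fine (P (B n)) = 1 - (1 - p) ^+ M.
  rewrite -sum_geom; apply: eq_bigr => n _.
  by rewrite PB subKr.
rewrite PBM subKr in h3.
rewrite (_ : 2 * C_K * xi / sigma ^+ 3 = 2 * K); last by rewrite /K; ring.
move: h1 h2 h3 h4.
move: (fine _) (normal_mix _ _ _) (rcdf _ _) (\sum_(_ < _) _) (_ ^+ M).
move: (2 * K * _).
move=> v1 v2 v3 v4 v5 v6.
rewrite !ler_norml => /andP[? ?] /andP[? ?] /andP[? ?] /andP[? ?].
by apply/andP; split; lra.
Unshelve. all: by end_near. Qed.
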